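(* Let $H$ be a hypergraph, let $E,F\subseteq E(H)$ with $E\cap F=\emptyset$, and let $r$ be a real number. Then the ratio $|E_v(H)\cap E|:|E_v(H)\cap F|=r$ for all $v\in V(H)$ (that is, $|E_v(H)\cap E|=r\,|E_v(H)\cap F|$ for all $v\in V(H)$) if and only if the vector $\alpha=\chi_E-r\chi_F$ belongs to the null space of $I_H$.
   Context: A hypergraph $H$ is a pair $(V(H),E(H))$ with $V(H)$ a non-empty finite set (vertices) and $E(H)$ a set of non-empty subsets of $V(H)$ (hyperedges). The vertex-edge incidence matrix $I_H$ has rows indexed by $V(H)$ and columns indexed by $E(H)$, with $(v,e)$ entry equal to $1$ if $v\in e$ and $0$ otherwise. The star of a vertex $v$ is $E_v(H)=\{e\in E(H): v\in e\}$; for $\alpha:E(H)\to\mathbb{C}$, $(I_H\alpha)(v)=\sum_{e\in E_v(H)}\alpha(e)$. For $E\subseteq E(H)$, $\chi_E:E(H)\to\{0,1\}$ is the characteristic function of $E$. The relation $a:b=r$ is understood as $a=rb$. *)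

(* Defs.v *)
From mathcomp Require Import all_boot all_order all_algebra.
From mathcomp Require Import reals.
From mathcomp.real_closed Require Import complex.

Set Implicit Arguments.
Unset Strict Implicit.
Unset Printing Implicit Defensive.

Import GRing.Theory.

Local Open Scope ring_scope.

Record hypergraph := Hypergraph {
  vertex : finType;
  hyperedges : {set {set vertex}};
  vertex_nonempty : (0 < #|vertex|)%N;
  hyperedges_nonempty : set0 \notin hyperedges
}.

(* E(H) as a finite type, so that subsets of E(H) have type {set hedge H}. *)
Definition hedge (H : hypergraph) : predArgType :=
  {e : {set vertex H} | e \in hyperedges H}.

Definition star (H : hypergraph) (v : vertex H) : {set hedge H} :=
  [set e : hedge H | v \in val e].

(* Rows and columns are numbered by the standard enumerations of V(H), E(H). *)
Definition incidence_mx (K : nzRingType) (H : hypergraph) :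
    'M[K]_(#|vertex H|, #|hedge H|) :=
  \matrix_(i, j) ((enum_val i : vertex H) \in val (enum_val j : hedge H))%:R.

Definition charfun (K : nzRingType) (T : finType) (A : {set T}) :
    {ffun T -> K} :=
  [ffun x => (x \in A)%:R].

Definition vec_of_fun (K : nzRingType) (T : finType) (f : {ffun T -> K}) :
    'cV[K]_#|T| :=
  \col_j f (enum_val j).

(* The space of column vectors x with A *m x = 0 (kermx acts on row vectors). *)
Definition null_space (K : fieldType) (m n : nat) (A : 'M[K]_(m, n)) :
    {vspace 'cV[K]_n} :=
  lker (linfun (mulmx A)).

(* Main.v *)
Require Import Defs.
From mathcomp Require Import all_boot all_order all_algebra.
From mathcomp Require Import reals.
From mathcomp.real_closed Require Import complex.

(** Row [v] of the incidence matrix is the indicator of the star of [v], so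
    multiplying the matrix by a function on hyperedges sums that function over
    each star ([incidence_mx_mul]).  Summing an indicator over a star counts an
    intersection ([sum_charfun]), hence the entry at [v] of the product with
    [chi_E - r chi_F] is [|E_v :&: E| - r |E_v :&: F|].  All these entries
    vanish exactly when the ratio condition holds at every vertex; the
    condition is over the reals and the entries are complex, which is harmless
    because the embedding of the reals is an injective ring morphism. *)

Import GRing.Theory.

Local Open Scope ring_scope.
Local Open Scope complex_scope.

Lemma mem_null_space (K : fieldType) (m n : nat) (A : 'M[K]_(m, n))
    (x : 'cV[K]_n) : (x \in null_space A) = (A *m x == 0).
Proof. by rewrite memv_ker lfunE. Qed.

Lemma sum_charfun (K : nzRingType) (T : finType) (A B : {set T}) :
  \sum_(x in A) charfun K B x = (#|A :&: B|)%:R.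
Proof.
rewrite (eq_bigr _ (fun x _ => ffunE _ x)) -natr_sum -sum1_card big_mkcond.
rewrite [in RHS]big_mkcond; congr _%:R; apply: eq_bigr => x _.
by rewrite inE; case: (x \in A); case: (x \in B).
Qed.

(** Passes from matrix entries numbered by enumerations to a sum over a set of
    hyperedges, where counting arguments apply. *)
Lemma incidence_mx_mul (K : nzRingType) (H : hypergraph)
    (f : {ffun hedge H -> K}) (i : 'I_#|vertex H|) :
  (incidence_mx K H *m vec_of_fun f) i 0 = \sum_(e in star (enum_val i)) f e.
Proof.
rewrite mxE [RHS]big_mkcond [RHS](reindex _ (onW_bij _ (enum_val_bij _))) /=.
apply: eq_bigr => j _; rewrite !mxE inE.
by case: ifP; rewrite (mul1r, mul0r).
Qed.

Theorem theorem2p33 (R : realType) (H : hypergraph) (E F : {set hedge H})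
    (r : R) (disjEF : E :&: F = set0) :
  (forall v : vertex H,
     (#|star v :&: E|)%:R = r * (#|star v :&: F|)%:R :> R) <->
  vec_of_fun [ffun e => charfun R[i] E e - r%:C * charfun R[i] F e]
    \in null_space (incidence_mx R[i] H).
Proof.
rewrite mem_null_space.
set f := [ffun e => _].
have star_sum v : \sum_(e in star v) f e =
    ((#|star v :&: E|)%:R - r * (#|star v :&: F|)%:R)%:C.
  rewrite (eq_bigr _ (fun e _ => ffunE _ e)) sumrB -mulr_sumr !sum_charfun.
  by rewrite rmorphB rmorphM /= !rmorph_nat.
split=> [ratio | /eqP/matrixP prod0 v].
  apply/eqP/matrixP=> i j.
  by rewrite ord1 incidence_mx_mul star_sum ratio subrr mxE.
have := prod0 (enum_rank v) 0.
rewrite incidence_mx_mul enum_rankK star_sum mxE.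
by move/eqP; rewrite fmorph_eq0 subr_eq0 => /eqP.
Qed.
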